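(* Let $q$ be an odd prime power, and let $f:\mathbb{F}_{q^2} \to \mathbb{R}$ be the function defined by $$f(\gamma):=\begin{cases} 1, & \text{if } \gamma \in Q_0;\\ -1, & \text{if } \gamma \in Q_1;\\ 0, & \text{otherwise.}\end{cases}$$ (1) If $q \equiv 1 \pmod 4$, then $f$ is an eigenfunction of $P(q^2)$ corresponding to the eigenvalue $\theta_2 = \frac{-1-q}{2}$, and $|\mathrm{Supp}(f)| = q+1$. (2) If $q \equiv 3 \pmod 4$, then $f$ is an eigenfunction of $P(q^2)$ corresponding to the eigenvalue $\theta_1 = \frac{-1+q}{2}$, and $|\mathrm{Supp}(f)| = q+1$.
   Context: For an odd prime power $q$, the Paley graph $P(q^2)$ is the graph with vertex set the finite field $\mathbb{F}_{q^2}$ in which two distinct elements are adjacent iff their difference is a square in the multiplicative group $\mathbb{F}_{q^2}^*$. Let $\beta$ be a primitive element of $\mathbb{F}_{q^2}$ (a generator of $\mathbb{F}_{q^2}^*$), and put $\omega := \beta^{q-1}$, so that $Q := \langle \omega \rangle$ is the subgroup of order $q+1$ of $\mathbb{F}_{q^2}^*$. Put $Q_0 := \{1, \omega^2, \omega^4, \ldots, \omega^{q-1}\}$ and $Q_1 := \{\omega, \omega^3, \omega^5, \ldots, \omega^{q}\}$. An eigenfunction of a graph $\Gamma$ corresponding to an eigenvalue $\theta$ is a real-valued function $f$ on the vertex set of $\Gamma$, having at least one non-zero value, such that for every vertex $\gamma$ one has $\theta \cdot f(\gamma) = \sum_{\delta \in \Gamma(\gamma)} f(\delta)$, where $\Gamma(\gamma)$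 is the set of neighbours of $\gamma$. The support $\mathrm{Supp}(f)$ is the set of vertices at which $f$ is non-zero. *)

(* Defs.v *)
(* MathComp world, with the real numbers of MathComp-Analysis (realType). *)
From mathcomp Require Import all_boot all_order all_algebra all_fingroup.
From mathcomp Require Import all_solvable all_field.
From mathcomp Require Import reals.

Set Implicit Arguments.
Unset Strict Implicit.
Unset Printing Implicit Defensive.

Import Order.TTheory GRing.Theory Num.Theory.

Local Open Scope ring_scope.

Definition neighbours (T : finType) (adj : rel T) (x : T) : {set T} :=
  [set y | adj x y].

Definition eigenfunction (R : realType) (T : finType) (adj : rel T)
    (theta : R) (f : T -> R) : Prop :=
  (exists x, f x != 0) /\
  (forall x, theta * f x = \sum_(y in neighbours adj x) f y).

Definition odd_prime_power (q : nat) : Prop :=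
  odd q /\ exists p k : nat, [/\ prime p, (0 < k)%N & q = (p ^ k)%N].

(* P(q^2) is [paley F] for a finite field F with q^2 elements; -1 is then a
   square, so that the relation is symmetric. *)
Definition paley (F : finFieldType) : rel F :=
  fun x y => (x != y) && [exists u : {unit F}, x - y == val (u ^+ 2)%g].

Definition primitive_elt (F : finFieldType) (beta : {unit F}) : bool :=
  generator [set: {unit F}] beta.

Definition omega (F : finFieldType) (q : nat) (beta : {unit F}) : F :=
  val (beta ^+ (q - 1))%g.

(* The exponents range over 0, ..., q: for q odd, the even ones end at q - 1
   and the odd ones at q. *)
Definition Q0 (F : finFieldType) (q : nat) (beta : {unit F}) : {set F} :=
  [set omega q beta ^+ i | i : 'I_q.+1 & ~~ odd i].

Definition Q1 (F : finFieldType) (q : nat) (beta : {unit F}) : {set F} :=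
  [set omega q beta ^+ i | i : 'I_q.+1 & odd i].

Definition paley_fun (R : realType) (F : finFieldType) (q : nat)
    (beta : {unit F}) (x : F) : R :=
  if x \in Q0 q beta then 1 else if x \in Q1 q beta then -1 else 0.

Definition supp (R : realType) (T : finType) (f : T -> R) : {set T} :=
  [set x | f x != 0].

(* Main.v *)
Require Import Defs.
From mathcomp Require Import all_boot all_order all_algebra all_fingroup.
From mathcomp Require Import all_solvable all_field.
From mathcomp Require Import reals.
From mathcomp Require Import zify ring.

Set Implicit Arguments.
Unset Strict Implicit.
Unset Printing Implicit Defensive.

Import Order.TTheory GRing.Theory Num.Theory.

Local Open Scope ring_scope.

(** Let f be the function of the theorem, m = (q + 1) / 2, and let chi be the
quadratic character of F, with chi 0 = 0. Since Q is the group of elements of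
norm x ^+ q.+1 = 1, the function f is the quadratic character of the cyclic
group Q, extended by zero: f y is the sign y ^+ m. By Euler's criterion
chi z is the sign (z ^+ (q - 1)) ^+ m, so it is f evaluated at the element
z ^+ (q - 1) of Q.

Two vertices x != y are adjacent exactly when chi (x - y) = 1, and f sums to
zero, so the sum of f over the neighbours of x is
(- f x + S x) / 2 with S x = \sum_y f y * chi (x - y)
([sum_neighbours_paley]). It remains to show S x = (-1) ^+ m * q * f x.

For y in Q distinct from x, multiplicativity of f on Q gives
f y * chi (x - y) = f (y * (x - y) ^+ (q - 1)) ([paley_fun_chi]). As the
Frobenius map is additive and y ^+ q = y^-1, the argument on the right is
(x ^+ q * y - 1) / (x - y): a Moebius transformation of y, whose determinant
vanishes exactly when x lies in Q ([moebiusM]).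
- If x is not in Q, this transformation permutes Q, so S x is the sum of f over
  Q, which is 0 ([sum_chi_out]).
- If x is in Q, it is constant, equal to - x ^+ q, so each of the q terms with
  y != x is f (- x ^+ q) = (-1) ^+ m * f x ([sum_chi_in]).

Finally (-1) ^+ m is -1 when q is 1 modulo 4, and 1 when q is 3 modulo 4. *)

(** * Primitive roots of even order *)

Lemma primitive_root_beta (F : finFieldType) (beta : {unit F}) :
  primitive_elt beta -> #|F|.-1.-primitive_root (val beta).
Proof.
rewrite /primitive_elt /generator => /eqP gen_beta.
have ord_beta : #[beta]%g = #|F|.-1.
  by rewrite /order -gen_beta card_finField_unit.
have beta_n : val beta ^+ #|F|.-1 = 1.
  by rewrite -FinRing.val_unitX -ord_beta expg_order.
have n_gt0 : (0 < #|F|.-1)%N by rewrite -ord_beta order_gt0.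
have [n prim_n dvd_n] := prim_order_exists n_gt0 beta_n.
suff -> : #|F|.-1 = n by [].
apply/eqP; rewrite eqn_dvd dvd_n andbT -ord_beta order_dvdn.
by apply/eqP/val_inj; rewrite FinRing.val_unitX /= (prim_expr_order prim_n).
Qed.

Lemma primitive_root_half (F : fieldType) (k : nat) (z : F) :
  (0 < k)%N -> k.*2.-primitive_root z -> z ^+ k = -1.
Proof.
move=> k_gt0 prim_z.
have : (z ^+ k) ^+ 2 == 1 by rewrite -exprM muln2 (prim_expr_order prim_z).
rewrite sqrf_eq1 => /orP[|/eqP//].
rewrite -(prim_order_dvd prim_z) => /(dvdn_leq k_gt0).
by rewrite -addnn -{3}[k]addn0 leq_add2l leqNgt k_gt0.
Qed.

(** A root of unity of even order keeps F away from characteristic 2, so that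
the two signs are distinct. *)
Lemma oner_neqN1 (F : fieldType) (k : nat) (z : F) :
  (0 < k)%N -> k.*2.-primitive_root z -> -1 != 1 :> F.
Proof.
move=> k_gt0 prim_z; rewrite -(primitive_root_half k_gt0 prim_z).
rewrite -(prim_order_dvd prim_z); apply/negP => /(dvdn_leq k_gt0).
by rewrite -addnn -{3}[k]addn0 leq_add2l leqNgt k_gt0.
Qed.

(** * Signs of a field as real numbers *)

Section Sign.
Variables (R : realType) (F : fieldType).
Hypothesis N1_neq1 : -1 != 1 :> F.

(** The value 0 off the two signs makes this describe both a quadratic character
at 0 and a function supported on a subgroup. *)
Definition real_sign (z : F) : R :=
  if z == 1 then 1 else if z == -1 then -1 else 0.

Lemma real_sign0 : real_sign 0 = 0.
Proof. by rewrite /real_sign eq_sym oner_eq0 eq_sym oppr_eq0 oner_eq0. Qed.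

Lemma real_sign_exp n : real_sign ((-1) ^+ n) = (-1) ^+ n.
Proof.
rewrite -(signr_odd F) -(signr_odd R) /real_sign.
by case: (odd n); rewrite ?expr0 ?expr1 ?eqxx // (negPf N1_neq1).
Qed.

Lemma real_signM (a c : F) : a ^+ 2 = 1 -> c ^+ 2 = 1 ->
  real_sign (a * c) = real_sign a * real_sign c.
Proof.
have sgnP (x : F) : x ^+ 2 = 1 -> exists n, x = (-1) ^+ n.
  by move/eqP; rewrite sqrf_eq1 => /orP[] /eqP->; [exists 0%N | exists 1%N].
by move=> /sgnP[i ->] /sgnP[j ->]; rewrite -exprD !real_sign_exp exprD.
Qed.

End Sign.

(** * The function as a quadratic character of the norm-one group *)

Section PaleyEigenfunction.
Variables (R : realType) (q : nat) (F : finFieldType) (beta : {unit F}).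
Hypotheses (q_pp : odd_prime_power q) (card_F : #|F| = (q ^ 2)%N).
Hypothesis gen_beta : primitive_elt beta.

Let m := q.+1./2.
Let k := ((q - 1) * m)%N.
Let w := omega q beta.
Let f : F -> R := paley_fun R q beta.
Let sgn : F -> R := @real_sign R F.
(** The quadratic character of F, in the form given by Euler's criterion: k is
half the order of the multiplicative group. *)
Let chi (z : F) : R := sgn (z ^+ k).

Definition norm1 : {set F} := [set y : F | y ^+ q.+1 == 1].

Let m2 : m.*2 = q.+1.
Proof. by have [q_odd _] := q_pp; rewrite -[RHS]odd_double_half /= q_odd. Qed.

Let q_gt1 : (1 < q)%N.
Proof.
case: q_pp => _ [p [e [p_pr e_gt0 ->]]].
by rewrite (leq_trans (prime_gt1 p_pr)) // -{1}[p]expn1 leq_exp2l // prime_gt1.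
Qed.

Let m_gt0 : (0 < m)%N. Proof. by rewrite -double_gt0 m2. Qed.
Let k_gt0 : (0 < k)%N. Proof. by rewrite muln_gt0 m_gt0 subn_gt0 q_gt1. Qed.

Let k2 : k.*2 = #|F|.-1.
Proof. by rewrite card_F /k doubleMr m2 -subn1 -(addn1 q) -(subn_sqr q 1). Qed.

Let prim_beta : k.*2.-primitive_root (val beta).
Proof. by rewrite k2 primitive_root_beta. Qed.

Let wE : w = val beta ^+ (q - 1).
Proof. by rewrite /w /omega FinRing.val_unitX. Qed.

Let prim_w : m.*2.-primitive_root w.
Proof.
have kE : k.*2 = ((q - 1) * m.*2)%N by rewrite doubleMr.
have dvd_k : (m.*2 %| k.*2)%N by rewrite kE dvdn_mull.
by have := dvdn_prim_root prim_beta dvd_k; rewrite kE mulnK ?double_gt0 // -wE.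
Qed.

Let N1_neq1 : -1 != 1 :> F. Proof. exact: oner_neqN1 m_gt0 prim_w. Qed.

(** q is a power of the characteristic because its square is the order of F. *)
Lemma frobenius_sub (x y : F) : (x - y) ^+ q = x ^+ q - y ^+ q.
Proof.
case: q_pp => q_odd [p [e [p_pr e_gt0 qE]]].
have pF : p \in [pchar F].
  by apply: (@card_finPcharP _ p (e * 2)) => //; rewrite card_F qE expnM.
rewrite GRing.exprDn_pchar; first by rewrite exprNn -signr_odd q_odd mulN1r.
by rewrite (eq_pnat _ (pcharf_eq pF)) qE pnatX pnat_id.
Qed.

Lemma norm1P (y : F) : reflect (exists i : 'I_q.+1, y = w ^+ i) (y \in norm1).
Proof.
rewrite inE; apply: (iffP eqP) => [y1 | [i ->]].
  have pw : q.+1.-primitive_root w by rewrite -m2.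
  by have [i ->] := prim_rootP pw y1; exists i.
by rewrite exprAC -{1}m2 (prim_expr_order prim_w) expr1n.
Qed.

Let w_m i : (w ^+ i) ^+ m = (-1) ^+ i.
Proof. by rewrite -exprM mulnC exprM (primitive_root_half m_gt0 prim_w). Qed.

(** Since w ^+ m = -1, the power of exponent m of w ^+ i reads off the
parity of i. *)
Lemma paley_funE (y : F) : f y = sgn (y ^+ m).
Proof.
rewrite /f /paley_fun /sgn /real_sign.
have Q0E : (y \in Q0 q beta) = (y ^+ m == 1).
  apply/imsetP/eqP => [[i i_even ->] | ym].
    by rewrite -/w w_m -signr_odd; move: i_even; rewrite !inE => /negPf->.
  have /norm1P[i yE] : y \in norm1 by rewrite inE -m2 -muln2 exprM ym expr1n.
  exists i => //; rewrite inE; apply/negP => i_odd.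
  by move: ym; rewrite yE w_m -signr_odd i_odd => /eqP; apply/negP.
have Q1E : (y \in Q1 q beta) = (y ^+ m == -1).
  apply/imsetP/eqP => [[i i_odd ->] | ym].
    by rewrite -/w w_m -signr_odd; move: i_odd; rewrite !inE => ->.
  have /norm1P[i yE] : y \in norm1.
    by rewrite inE -m2 -muln2 exprM ym sqrrN expr1n.
  exists i => //; rewrite inE; apply: contraT => /negPf i_even.
  move: ym; rewrite yE w_m -signr_odd i_even => /esym/eqP.
  by rewrite (negPf N1_neq1).
by rewrite Q0E Q1E.
Qed.

Lemma paley_fun_omega (i : nat) : f (w ^+ i) = (-1) ^+ i.
Proof. by rewrite paley_funE w_m /sgn real_sign_exp. Qed.

Lemma paley_fun_eq0 (y : F) : (f y == 0) = (y \notin norm1).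
Proof.
case: (boolP (y \in norm1)) => [/norm1P[i ->] | y_out] /=.
  by rewrite paley_fun_omega signr_eq0.
rewrite paley_funE /sgn /real_sign.
move: y_out; rewrite inE -m2 -muln2 exprM sqrf_eq1 negb_or.
by case/andP => /negPf-> /negPf->; rewrite eqxx.
Qed.

Lemma card_norm1 : #|norm1| = q.+1.
Proof.
have -> : norm1 = [set w ^+ i | i : 'I_q.+1].
  by apply/setP => y; apply/norm1P/imsetP => [[i ->] | [i _ ->]]; exists i.
rewrite card_imset ?card_ord // => i j /eqP.
have pw : q.+1.-primitive_root w by rewrite -m2.
rewrite (eq_prim_root_expr pw) !modn_small ?ltn_ord // => /eqP.
exact: val_inj.
Qed.

Lemma card_supp_paley_fun : #|supp f| = (q + 1)%N.
Proof.
rewrite addn1 -card_norm1; congr #|pred_of_set _|; apply/setP => y.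
by rewrite inE paley_fun_eq0 negbK.
Qed.

Lemma sum_norm1 (g : F -> R) :
  \sum_(y in norm1) f y * g y = \sum_y f y * g y.
Proof.
apply: big_rmcond => y; rewrite -paley_fun_eq0 => /eqP->.
by rewrite mul0r.
Qed.

(** Multiplication by the generator w of the norm-one group permutes F and
negates f, so the sum is its own opposite. *)
Lemma sum_paley_fun : \sum_y f y = 0.
Proof.
have w_neq0 : w != 0 by rewrite (prim_root_eq0 prim_w) -lt0n double_gt0.
have fN y : f (w * y) = - f y.
  case: (boolP (y \in norm1)) => [/norm1P[i ->] | y_out].
    by rewrite -exprS !paley_fun_omega exprS mulN1r.
  have /eqP-> : f y == 0 by rewrite paley_fun_eq0.
  apply/eqP; rewrite oppr0 paley_fun_eq0; move: y_out.
  by rewrite !inE exprMn -m2 (prim_expr_order prim_w) mul1r.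
apply/eqP; rewrite -eqNr -sumrN; apply/eqP.
rewrite [RHS](reindex_inj (mulfI w_neq0)) /=.
by apply: eq_bigr => y _; rewrite fN.
Qed.

(** * Adjacency in terms of the quadratic character *)

Lemma square_exp_k (z : F) : z != 0 -> (z ^+ k) ^+ 2 = 1.
Proof.
move=> z0; rewrite -exprM muln2 k2; apply: (mulfI z0); rewrite mulr1 -exprS.
by rewrite prednK ?expf_card // card_F expn_gt0 (ltnW q_gt1).
Qed.

(** Euler's criterion. For the converse, the difference is a power beta ^+ j;
since beta ^+ k = -1, its power of exponent k is 1 only when j is even. *)
Lemma paleyE (x y : F) : paley x y = (x != y) && ((x - y) ^+ k == 1).
Proof.
rewrite /paley; case: (boolP (x != y)) => // ne_xy; rewrite !andTb.
have d0 : x - y != 0 by rewrite subr_eq0.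
apply/existsP/eqP => [[u /eqP uE] | dk].
  have {}uE : x - y = (val u : F) ^+ 2 by rewrite uE FinRing.val_unitX.
  rewrite uE exprAC square_exp_k //; apply: contraNneq d0 => u0.
  by rewrite uE u0 expr0n.
have := square_exp_k d0; rewrite -exprM muln2 => /(prim_rootP prim_beta)[j dE].
have j_even : ~~ odd j.
  apply/negP => j_odd; move: dk; rewrite dE -exprM mulnC exprM.
  rewrite (primitive_root_half k_gt0 prim_beta) -signr_odd j_odd => /eqP.
  exact/negP.
exists (beta ^+ j./2)%g.
by rewrite -expgM muln2 even_halfK // FinRing.val_unitX dE.
Qed.

(** For y != x the indicator of adjacency is (1 + chi (x - y)) / 2. Summing f
against it, the constant part contributes - f x because f sums to 0 and the
term y = x is left out; the term y = x in the other part vanishes with chi 0. *)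
Lemma sum_neighbours_paley (x : F) :
  \sum_(y in neighbours (@paley F) x) f y
    = (- f x + \sum_y f y * chi (x - y)) / 2.
Proof.
have two_neq0 : 2 != 0 :> R by rewrite pnatr_eq0.
apply: (mulIf two_neq0); rewrite divfK // mulr_suml.
have := sum_paley_fun; rewrite (bigD1 x) //= => /eqP.
rewrite addrC addr_eq0 => /eqP <-; rewrite [X in _ + X](bigD1 x) //=.
rewrite subrr /chi expr0n eqn0Ngt k_gt0 /sgn real_sign0 mulr0 add0r -big_split.
rewrite /neighbours big_mkcond [RHS]big_mkcond /=.
apply: eq_bigr => y _; rewrite inE paleyE eq_sym.
case: eqVneq => //= ne_yx.
have : ((x - y) ^+ k) ^+ 2 == 1.
  by rewrite square_exp_k // subr_eq0 eq_sym.
rewrite sqrf_eq1 /real_sign => /orP[] /eqP->.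
  by rewrite eqxx mulr1 mulr_natr mulr2n.
by rewrite eqxx (negPf N1_neq1) mulrN1 subrr.
Qed.

(** * The Moebius transformation attached to a vertex *)

(** On the norm-one group this is y |-> (x ^+ q * y - 1) / (x - y); the power
form is the one in which the value of f can be computed. *)
Definition moebius (x y : F) : F := y * (x - y) ^+ (q - 1).

(** Here (x - y) ^+ q = x ^+ q - y ^+ q, and y * y ^+ q = 1. *)
Lemma moebiusM (x y : F) : y \in norm1 ->
  moebius x y * (x - y) = x ^+ q * y - 1.
Proof.
rewrite inE => /eqP y1.
rewrite /moebius -mulrA -exprSr subn1 prednK ?(ltnW q_gt1) //.
by rewrite frobenius_sub mulrBr -exprS y1 mulrC.
Qed.

(** Both factors are signs of powers of exponent m, namely of y and of
(x - y) ^+ (q - 1), and the sign map is multiplicative. *)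
Lemma paley_fun_chi (x y : F) : y \in norm1 -> x != y ->
  f y * chi (x - y) = f (moebius x y).
Proof.
rewrite inE => /eqP y1 ne_xy.
rewrite !paley_funE /chi /sgn /moebius exprMn -exprM.
rewrite [RHS]real_signM // ?square_exp_k ?subr_eq0 //.
by rewrite -exprM muln2 m2.
Qed.

Lemma norm1_moebius (x y : F) : y \in norm1 -> x != y -> moebius x y \in norm1.
Proof.
move=> y1 ne_xy; move: (y1); rewrite !inE /moebius exprMn => /eqP->.
by rewrite -m2 mul1r -muln2 -exprM mulnA exprM square_exp_k // subr_eq0.
Qed.

(** The determinant of the transformation is, up to sign, x ^+ q.+1 - 1, which
is nonzero for x off the norm-one group. *)
Lemma moebius_inj (x : F) : x \notin norm1 ->
  {in norm1 &, injective (moebius x)}.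
Proof.
move=> x_out y z y1 z1 eq_yz.
have eq1 := moebiusM x y1; have eq2 := moebiusM x z1.
have det0 : x ^+ q.+1 - 1 != 0 by rewrite subr_eq0; move: x_out; rewrite inE.
have : (x ^+ q * y - 1) * (x - z) = (x ^+ q * z - 1) * (x - y).
  by rewrite -eq1 -eq2 eq_yz -!mulrA [(x - y) * _]mulrC.
move/eqP; rewrite -subr_eq0.
have -> : (x ^+ q * y - 1) * (x - z) - (x ^+ q * z - 1) * (x - y)
        = (x ^+ q.+1 - 1) * (y - z) by rewrite exprS; ring.
by rewrite mulf_eq0 (negPf det0) subr_eq0 => /eqP.
Qed.

(** The injective map sends the finite norm-one group into itself, hence
permutes it, and the sum becomes the total sum of f. *)
Lemma sum_chi_out (x : F) : x \notin norm1 -> \sum_y f y * chi (x - y) = 0.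
Proof.
move=> x_out; rewrite -sum_norm1.
have ne_x y : y \in norm1 -> x != y by apply: contraTneq => <-.
rewrite (eq_bigr (fun y => f (moebius x y))); last first.
  by move=> y y1; rewrite paley_fun_chi ?ne_x.
rewrite -(big_imset f (moebius_inj x_out)) /=.
have -> : moebius x @: norm1 = norm1.
  apply/eqP; rewrite eqEcard (card_in_imset (moebius_inj x_out)) leqnn andbT.
  by apply/subsetP => _ /imsetP[y y1 ->]; rewrite norm1_moebius ?ne_x.
rewrite -[RHS]sum_paley_fun; apply: big_rmcond => y.
by rewrite -paley_fun_eq0 => /eqP.
Qed.

(** The determinant now vanishes: with x * x ^+ q = 1 the numerator
x ^+ q * y - 1 is - x ^+ q * (x - y). *)
Lemma moebius_const (x y : F) : x \in norm1 -> y \in norm1 -> x != y ->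
  moebius x y = - x ^+ q.
Proof.
move=> x1 y1 ne_xy; have d0 : x - y != 0 by rewrite subr_eq0.
apply: (mulIf d0); rewrite moebiusM //; move: x1; rewrite inE => /eqP <-.
by rewrite exprS; ring.
Qed.

(** f (-1) is the sign (-1) ^+ m, and raising to the odd power q does not change
the sign. *)
Lemma paley_fun_conj (x : F) : x \in norm1 -> f (- x ^+ q) = (-1) ^+ m * f x.
Proof.
case/norm1P => i ->; have [q_odd _] := q_pp.
rewrite paley_fun_omega paley_funE [X in sgn X]exprNn [_ ^+ q ^+ m]exprAC w_m.
rewrite -[_ ^+ i ^+ q]exprM mulnC exprM -(signr_odd _ q) q_odd expr1.
by rewrite -[X in sgn X]exprD /sgn real_sign_exp // exprD.
Qed.

Lemma sum_chi_in (x : F) : x \in norm1 ->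
  \sum_y f y * chi (x - y) = (-1) ^+ m * q%:R * f x.
Proof.
move=> x1; rewrite -sum_norm1 (bigD1 x) //=.
rewrite subrr /chi expr0n eqn0Ngt k_gt0 /sgn real_sign0 mulr0 add0r.
rewrite (eq_bigr (fun=> (-1) ^+ m * f x)) => [|y /andP[y1 ne_yx]].
  rewrite sumr_const mulrAC mulr_natr; congr (_ *+ _).
  have := card_norm1; rewrite (cardD1 x) x1 add1n => -[<-].
  by apply: eq_card => y; rewrite [LHS]unfold_in [RHS]inE andbC.
have ne_xy : x != y by rewrite eq_sym.
by rewrite -/(sgn _) -/(chi _) paley_fun_chi // moebius_const // paley_fun_conj.
Qed.

(** * The eigenvalue *)

Lemma eigenfunction_paley_fun :
  eigenfunction (@paley F) ((-1 + (-1) ^+ m * q%:R) / 2 : R) f.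
Proof.
split.
  by exists (w ^+ 0); rewrite paley_fun_omega signr_eq0.
move=> x; rewrite sum_neighbours_paley mulrAC; congr (_ / _).
rewrite mulrDl mulN1r; congr (_ + _).
have [x1 | x_out] := boolP (x \in norm1); first by rewrite sum_chi_in.
move: (x_out); rewrite -paley_fun_eq0 => /eqP->.
by rewrite mulr0 sum_chi_out.
Qed.

End PaleyEigenfunction.

Theorem theorem2 (R : realType) (q : nat) (F : finFieldType)
    (beta : {unit F}) :
  odd_prime_power q -> #|F| = (q ^ 2)%N -> primitive_elt beta ->
  ((q = 1 %[mod 4])%N ->
     eigenfunction (@paley F) ((-1 - q%:R) / 2 : R) (paley_fun R q beta) /\
     #|supp (paley_fun R q beta)| = (q + 1)%N) /\
  ((q = 3 %[mod 4])%N ->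
     eigenfunction (@paley F) ((-1 + q%:R) / 2 : R) (paley_fun R q beta) /\
     #|supp (paley_fun R q beta)| = (q + 1)%N).
Proof.
move=> q_pp card_F gen_beta.
have eig := eigenfunction_paley_fun R q_pp card_F gen_beta.
have supp_f := card_supp_paley_fun R q_pp card_F gen_beta.
split=> q_mod; split=> //.
  have m_odd : odd q.+1./2 by lia.
  by move: eig; rewrite -signr_odd m_odd mulN1r.
have m_even : odd q.+1./2 = false by lia.
by move: eig; rewrite -signr_odd m_even mul1r.
Qed.
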